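(* The functor $A\mapsto[A]$ from the category of weakly complete unital $\mathbb K$-algebras to the category of profinite-dimensional $\mathbb K$-Lie algebras has a left adjoint $\mathbf U$. Equivalently, for every profinite-dimensional Lie algebra $\mathfrak g$ there exist a weakly complete unital algebra $\mathbf U(\mathfrak g)$ and a continuous Lie algebra morphism $\lambda_{\mathfrak g}\colon\mathfrak g\to[\mathbf U(\mathfrak g)]$ such that for every weakly complete unital algebra $A$ and every continuous Lie algebra morphism $f\colon\mathfrak g\to[A]$ there is a unique continuous unital algebra morphism $f'\colon\mathbf U(\mathfrak g)\to A$ with $f=f'\circ\lambda_{\mathfrak g}$.
   Context: $\mathbb K\in\{\mathbb R,\mathbb C\}$. A topological $\mathbb K$-vector space is weakly complete if it is isomorphic to a power $\mathbb K^J$ (with the product topology) for some set $J$. A weakly complete unital algebra is a unital associative $\mathbb K$-algebra $A$ carrying a topology that makes it a weakly complete vector space and makes multiplication continuous; morphisms are continuous unital algebra homomorphisms. For such $A$, $[A]$ denotes the topological Lie algebra with the same underlying topological vector space and bracket $[x,y]=xy-yx$. For a topological $\mathbb K$-Lie algebra $\mathfrak g$ let $\mathcal I(\mathfrak g)$ be the set of closed ideals $I$ of $\mathfrak g$ with $\dim \mathfrak g/I<\infty$; $\mathfrak g$ is profinite-dimensional if the natural map $\mathfrak g\to\lim_{I\in\mathcal I(\mathfrak g)}\mathfrak g/I$ is an isomorphism of topological Lie algebras. Morphisms of profinite-dimensional Lie algebras are continuous Lie algebra homomorphisms. *)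

(* Defs.v *)
From HB Require Import structures.
From mathcomp Require Import all_boot all_order all_algebra.
From mathcomp Require Import complex.
From mathcomp Require Import all_classical all_reals all_analysis.

Set Implicit Arguments.
Unset Strict Implicit.
Unset Printing Implicit Defensive.

Import Order.TTheory GRing.Theory Num.Theory.
Import numFieldNormedType.Exports.
Local Open Scope classical_set_scope.
Local Open Scope ring_scope.

Definition ground_field (R : realType) (b : bool) : numFieldType :=
  if b then (R : numFieldType) else (R[i] : numFieldType).

Section Defs.
Variable K : numFieldType.

Definition weakly_complete (V : topologicalLmodType K) : Prop :=
  exists (J : Type) (phi : V -> {ptws J -> K^o}) (psi : {ptws J -> K^o} -> V),
    (forall (a : K) (x y : V) (j : J),
        phi (a *: x + y) j = a * phi x j + phi y j) /\
    cancel phi psi /\ cancel psi phi /\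
    continuous phi /\ continuous psi.

Definition unital_algebra (A : topologicalLmodType K) (mul : A -> A -> A)
    (one : A) : Prop :=
  [/\ associative mul,
      left_distributive mul +%R, right_distributive mul +%R,
      (forall (a : K) (x y : A), mul (a *: x) y = a *: mul x y) &
      (forall (a : K) (x y : A), mul x (a *: y) = a *: mul x y)] /\
  (left_id one mul /\ right_id one mul).

Definition wc_unital_algebra (A : topologicalLmodType K) (mul : A -> A -> A)
    (one : A) : Prop :=
  [/\ weakly_complete A, unital_algebra mul one &
      continuous (fun p : A * A => mul p.1 p.2)].

Definition wc_alg_morphism (A B : topologicalLmodType K)
    (mulA : A -> A -> A) (oneA : A) (mulB : B -> B -> B) (oneB : B)
    (f : A -> B) : Prop :=
  [/\ (forall (a : K) (x y : A), f (a *: x + y) = a *: f x + f y),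
      (forall x y : A, f (mulA x y) = mulB (f x) (f y)),
      f oneA = oneB & continuous f].

Definition lie_bracket (g : topologicalLmodType K) (br : g -> g -> g) : Prop :=
  [/\ (forall (a : K) (x y z : g), br (a *: x + y) z = a *: br x z + br y z),
      (forall (a : K) (x y z : g), br z (a *: x + y) = a *: br z x + br z y),
      (forall x : g, br x x = 0) &
      (forall x y z : g, br x (br y z) + br y (br z x) + br z (br x y) = 0)].

Definition topological_lie_algebra (g : topologicalLmodType K)
    (br : g -> g -> g) : Prop :=
  lie_bracket br /\ continuous (fun p : g * g => br p.1 p.2).

Definition lie_morphism_to_alg (g : topologicalLmodType K) (br : g -> g -> g)
    (A : topologicalLmodType K) (mulA : A -> A -> A) (f : g -> A) : Prop :=
  [/\ (forall (a : K) (x y : g), f (a *: x + y) = a *: f x + f y),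
      (forall x y : g, f (br x y) = mulA (f x) (f y) - mulA (f y) (f x)) &
      continuous f].

Section Profinite.
Variables (g : topologicalLmodType K) (br : g -> g -> g).

Definition cofinite_closed_ideal (I : set g) : Prop :=
  [/\ I 0, (forall (a : K) (x y : g), I x -> I y -> I (a *: x + y)),
      (forall x y : g, I y -> I (br x y)),
      closed I &
      exists s : seq g, forall x : g, exists c : seq K,
        I (x - \sum_(i < size s) c`_i *: s`_i)].

(* elements of lim_{I in I(g)} g/I, represented by families of
   representatives p I (the coset p I + I in g/I) *)
Definition compatible_family (p : set g -> g) : Prop :=
  forall I J : set g, cofinite_closed_ideal I -> cofinite_closed_ideal J ->
    J `<=` I -> I (p J - p I).

Definition same_limit_point (p q : set g -> g) : Prop :=
  forall I, cofinite_closed_ideal I -> I (p I - q I).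

Definition saturated (I W : set g) : Prop :=
  forall x y : g, W x -> I y -> W (x + y).

(* Open sets of the limit: the subspace topology of the product
   prod_I g/I, each g/I carrying the quotient topology (open subsets of g/I
   correspond to I-saturated open subsets of g). *)
Definition limit_open (S : set (set g -> g)) : Prop :=
  (forall p, S p -> compatible_family p) /\
  forall p, S p -> exists (n : nat) (Is Ws : 'I_n -> set g),
    (forall k, [/\ cofinite_closed_ideal (Is k), open (Ws k),
                  saturated (Is k) (Ws k) & Ws k (p (Is k))]) /\
    (forall q, compatible_family q -> (forall k, Ws k (q (Is k))) -> S q).

Definition nat_map (x : g) : set g -> g := fun _ => x.

(* g is profinite-dimensional: the natural map is an isomorphism of
   topological Lie algebras onto the limit (it is automatically a
   Lie algebra morphism for the induced bracket on the limit). *)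
Definition profinite_dimensional : Prop :=
  [/\
      (forall x y : g, same_limit_point (nat_map x) (nat_map y) -> x = y),
      (forall p, compatible_family p ->
         exists x : g, same_limit_point (nat_map x) p),
      (forall S, limit_open S -> open [set x : g | S (nat_map x)]) &
      (forall O : set g, open O ->
         limit_open [set p | compatible_family p /\
                             exists2 x, O x & same_limit_point (nat_map x) p])].

End Profinite.
End Defs.

(* Main.v *)
Require Import Defs.
From HB Require Import structures.
From mathcomp Require Import all_boot all_order all_algebra.
From mathcomp Require Import complex.
From mathcomp Require Import all_classical all_reals all_analysis.

(** The enveloping algebra is the algebraic dual of the space [E] of matrix
    coefficients, viewed as functions on words in [g], of the continuous
    finite-dimensional representations of [g].  A Hamel basis [J] of [E]
    identifies this dual with [K^J], and concatenation of words dualizes to the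
    multiplication [(ab)(phi) = a(w1 |-> b(w2 |-> phi(w1 w2)))], and
    [lambda x] is evaluation at the one-letter word [x].

    If [A] is a weakly complete algebra and [xi] is a continuous functional on
    [A], then [xi] depends on finitely many coordinates and, by continuity of
    the product, the form [xi(ab)] has finite rank.  A maximal invertible
    Gram matrix [M = (xi(x_i y_j))] then makes [b |-> (xi(x_i b y_j)) M^-1] a
    representation with [xi] among its coefficients.  Hence for a
    Lie morphism [f : g -> A] the function [w |-> xi(f(w_1) ... f(w_k))] lies
    in [E], and evaluating elements of the dual on these functions gives the
    required morphism into [A], coordinate by coordinate. *)

Set Implicit Arguments.
Unset Strict Implicit.
Unset Printing Implicit Defensive.

Import Order.TTheory GRing.Theory Num.Theory.
Import numFieldNormedType.Exports.
Local Open Scope classical_set_scope.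
Local Open Scope ring_scope.

(** * Pointwise topology and powers of the ground field *)

(** The product topology is a supremum of initial topologies, one for each evaluation; constant
    functions show that evaluations are surjective, as [cvg_image] requires. *)
Lemma ptws_cvg (J : Type) (T : topologicalType) (F : set_system {ptws J -> T})
    (f : {ptws J -> T}) : Filter F ->
  (forall j, (fun h : {ptws J -> T} => h j) @ F --> f j) -> F --> f.
Proof.
move=> FF cvF; apply/cvg_sup => j; apply/cvg_image.
  by rewrite eqEsubset; split=> // y _; exists (fun=> y).
move=> W /cvF /= FW; exists [set h : {ptws J -> T} | W (h j)] => //.
by rewrite eqEsubset; split=> [y [h Wh <-]//|y Wy]; exists (fun=> y).
Qed.

Lemma ptws_coord_continuous (J : Type) (T : topologicalType) (j : J) :
  continuous (fun h : {ptws J -> T} => h j).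
Proof. exact: (@proj_continuous {classic J} (fun=> T)). Qed.

Lemma ptws_continuous (S : topologicalType) (J : Type) (T : topologicalType)
    (F : S -> {ptws J -> T}) :
  (forall j, continuous (fun s => F s j)) -> continuous F.
Proof. by move=> cF s; apply: ptws_cvg => j; apply: cF. Qed.

(** A name of its own lets the product topology and the pointwise linear structure be combined into
    one topological module. *)
Definition power (K : numFieldType) (J : Type) := {ptws J -> K^o}.

HB.instance Definition _ (K : numFieldType) (J : Type) :=
  Topological.copy (power K J) {ptws J -> K^o}.
HB.instance Definition _ (K : numFieldType) (J : Type) :=
  GRing.Lmodule.copy (power K J) (J -> K^o).

Section ScalarContinuity.
Variables (K : numFieldType) (S : topologicalType).
Implicit Types f g : S -> K^o.

Lemma continuous_addf f g :
  continuous f -> continuous g -> continuous (fun s => f s + g s : K^o).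
Proof. by move=> cf cg s; apply: cvgD; [exact: cf|exact: cg]. Qed.

Lemma continuous_mulf f g :
  continuous f -> continuous g -> continuous (fun s => f s * g s : K^o).
Proof. by move=> cf cg s; apply: cvgM; [exact: cf|exact: cg]. Qed.

Lemma continuous_constf (c : K^o) : continuous (fun _ : S => c).
Proof. by move=> s; exact: cvg_cst. Qed.

Lemma continuous_sumf (I : Type) (r : seq I) (f : I -> S -> K^o) :
  (forall i, continuous (f i)) -> continuous (fun s => \sum_(i <- r) f i s : K^o).
Proof.
move=> cf; elim: r => [|i r IHr].
  by under eq_fun do rewrite big_nil; exact: continuous_constf.
by under eq_fun do rewrite big_cons; exact: continuous_addf.
Qed.

End ScalarContinuity.

Section PowerTopology.
Variables (K : numFieldType) (J : Type).

Lemma power_add_continuous :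
  continuous (fun x : power K J * power K J => x.1 + x.2).
Proof.
apply: ptws_continuous => j.
apply: (@continuous_addf K _ (fun x : power K J * power K J => x.1 j)
  (fun x => x.2 j)) => x.
- apply: (@continuous_comp _ _ _ fst (fun h : power K J => h j)).
    exact: cvg_fst.
  exact: (@ptws_coord_continuous J K^o j).
- apply: (@continuous_comp _ _ _ snd (fun h : power K J => h j)).
    exact: cvg_snd.
  exact: (@ptws_coord_continuous J K^o j).
Qed.

Lemma power_scale_continuous :
  continuous (fun z : K^o * power K J => z.1 *: z.2).
Proof.
apply: ptws_continuous => j.
apply: (@continuous_mulf K _ (fun x : K^o * power K J => x.1)
  (fun x => x.2 j)) => x.
- exact: cvg_fst.
- apply: (@continuous_comp _ _ _ snd (fun h : power K J => h j)).
    exact: cvg_snd.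
  exact: (@ptws_coord_continuous J K^o j).
Qed.

HB.instance Definition _ :=
  PreTopologicalNmodule_isTopologicalNmodule.Build (power K J)
    power_add_continuous.
HB.instance Definition _ :=
  TopologicalNmodule_isTopologicalLmodule.Build K (power K J)
    power_scale_continuous.

End PowerTopology.


(** * Hamel bases and the algebraic dual of a subspace *)

Section HamelBasis.
Variables (K : fieldType) (V : lmodType K).

Definition free_set (B : set V) := forall (s : seq V) (c : V -> K),
  uniq s -> (forall v, v \in s -> B v) -> \sum_(v <- s) c v *: v = 0 ->
  forall v, v \in s -> c v = 0.

(** A linear relation involves finitely many vectors, and some single member of the chain contains
    them all. *)
Lemma free_bigcup (F : set (set V)) :
  total_on F subset -> F `<=` free_set -> free_set (\bigcup_(X in F) X).
Proof.
move=> totF Ffree s c us sF s0.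
have [->|sn] := eqVneq s [::] => //.
have [X FX sX] : exists2 X, F X & forall v, v \in s -> X v.
  elim: s sn sF {us s0} => // x s IHs _ sF.
  have [X FX Xx] := sF x (mem_head _ _).
  have [->|sn] := eqVneq s [::].
    by exists X => // v; rewrite inE => /eqP ->.
  have [|Y FY sY] := IHs sn.
    by move=> v vs; apply: sF; rewrite inE vs orbT.
  have [XY|YX] := totF X Y FX FY; [exists Y => //|exists X => //];
    move=> v; rewrite inE => /orP[/eqP ->|/sY //]; [exact: XY|done|exact: YX].
exact: (Ffree X FX).
Qed.

(** Zorn gives a maximal free subset [B] of [E]. For [x] in [E] outside [B], adjoining [x] creates a
    relation; its coefficient at [x] is nonzero because [B] is free, so the relation can be solved
    for [x]. *)
Lemma hamel_basis (E : set V) : exists B : set V,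
  [/\ B `<=` E, free_set B & forall x, E x -> exists (s : seq V) (c : V -> K),
    [/\ uniq s, forall v, v \in s -> B v & x = \sum_(v <- s) c v *: v]].
Proof.
have [|B [[BE freeB] maxB]] := @Zorn_bigcup V [set B | B `<=` E /\ free_set B].
  move=> F FP totF; split; first by move=> x [X /FP[XE _] /XE].
  by apply: free_bigcup => // X /FP[].
exists B; split=> // x Ex.
have [Bx|Bx] := pselect (B x).
  exists [:: x], (fun=> 1); split=> //.
    by move=> v; rewrite inE => /eqP ->.
  by rewrite big_seq1 scale1r.
have : ~ free_set (B `|` [set x]).
  move=> freeBx; apply: (maxB (B `|` [set x])).
    split; first by move=> y; left.
    by move=> /(_ x) h; apply/Bx/h; right.
  by split=> // y [/BE|->].
move=> /existsNP[s] /existsNP[c] /not_implyP[us] /not_implyP[sB]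
  /not_implyP[s0] /existsNP[v] /not_implyP[vs /eqP cv].
have xs : x \in s.
  apply: contraNT cv => xs; apply/eqP; apply: (freeB s c us _ s0 v vs).
  by move=> w ws; have [//|wx] := sB w ws; rewrite -wx ws in xs.
have remB w : w \in rem x s -> B w.
  rewrite mem_rem_uniq // inE => /andP[/eqP wx ws].
  by have [|/wx] := sB w ws.
have urem : uniq (rem x s) by rewrite rem_uniq.
rewrite (perm_big _ (perm_to_rem xs)) big_cons /= in s0.
have cx : c x != 0.
  apply: contraNneq cv => cx; rewrite cx scale0r add0r in s0.
  have [<-|vx] := eqVneq x v; first by rewrite cx.
  apply/eqP/(freeB _ c urem remB s0).
  by rewrite mem_rem_uniq // inE eq_sym vx.
exists (rem x s), (fun v => - (c x)^-1 * c v); split=> //.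
under eq_bigr do rewrite -scalerA.
move/eqP: s0; rewrite addr_eq0 => /eqP cxx.
rewrite -scaler_sumr scaleNr -scalerN -cxx.
by rewrite scalerA mulVf // scale1r.
Qed.

Lemma sum_widen (M : nmodType) (s m : seq V) (F : V -> M) :
  uniq s -> uniq m -> {subset s <= m} ->
  \sum_(v <- s) F v = \sum_(v <- m) (if v \in s then F v else 0).
Proof.
move=> us um sm; rewrite -big_mkcond -big_filter; apply: perm_big.
apply: uniq_perm => //; first exact: filter_uniq.
by move=> v; rewrite mem_filter; case: (boolP (v \in s)) => // /sm ->.
Qed.

(** Prescribing values [a] on a free set gives a well-defined linear functional: padded with zeros
    to the common support [m], the coefficients of the two sides agree by freeness. *)
Lemma free_set_functional (B : set V) (a : V -> K) (k : K) (s t r : seq V)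
    (c d h : V -> K) : free_set B ->
  uniq s -> uniq t -> uniq r ->
  (forall v, v \in s -> B v) -> (forall v, v \in t -> B v) ->
  (forall v, v \in r -> B v) ->
  \sum_(v <- r) h v *: v
    = k *: (\sum_(v <- s) c v *: v) + \sum_(v <- t) d v *: v ->
  \sum_(v <- r) h v * a v
    = k * (\sum_(v <- s) c v * a v) + \sum_(v <- t) d v * a v.
Proof.
move=> freeB us ut ur sB tB rB.
pose m := undup (s ++ t ++ r); have um : uniq m by exact: undup_uniq.
have sm : {subset s <= m} by move=> v vs; rewrite mem_undup !mem_cat vs.
have tm : {subset t <= m} by move=> v vs; rewrite mem_undup !mem_cat vs orbT.
have rm : {subset r <= m} by move=> v vs; rewrite mem_undup !mem_cat vs !orbT.
have mB v : v \in m -> B v.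
  by rewrite mem_undup !mem_cat => /or3P[/sB|/tB|/rB].
pose co (q : seq V) (f : V -> K) v := if v \in q then f v else 0.
have coZ q f : uniq q -> {subset q <= m} ->
    \sum_(v <- q) f v *: v = \sum_(v <- m) co q f v *: v.
  move=> uq qm; rewrite (sum_widen _ uq um qm); apply: eq_bigr => v _.
  by rewrite /co; case: ifP => // _; rewrite scale0r.
have coM q f : uniq q -> {subset q <= m} ->
    \sum_(v <- q) f v * a v = \sum_(v <- m) co q f v * a v.
  move=> uq qm; rewrite (sum_widen _ uq um qm); apply: eq_bigr => v _.
  by rewrite /co; case: ifP => // _; rewrite mul0r.
rewrite (coZ r) // (coZ s) // (coZ t) // (coM r) // (coM s) // (coM t) //.
rewrite scaler_sumr mulr_sumr -!big_split /= => eqm.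
apply: eq_big_seq => v vm.
have := freeB m (fun v => co r h v - (k * co s c v + co t d v)) um mB _ v vm.
move=> /(_ _)/subr0_eq ->; first by rewrite mulrDl mulrA.
under eq_bigr do rewrite scalerBl scalerDl -scalerA.
by rewrite sumrB eqm subrr.
Qed.

(* [J -> K] is the dual of the subspace [E]: [ext] extends a function on the
   basis [e] to a linear functional on [E]. *)
Lemma basis_dual (E : set V) : exists (J : Type) (e : J -> V)
    (ext : (J -> K) -> V -> K),
  [/\ forall j, E (e j), forall a j, ext a (e j) = a j,
      forall a k x y, E x -> E y -> E (k *: x + y) ->
        ext a (k *: x + y) = k * ext a x + ext a y &
      forall x, E x -> exists (s : seq J) (c : J -> K),
        x = \sum_(j <- s) c j *: e j].
Proof.
have [B [BE freeB spanB]] := hamel_basis E.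
(* [sc] chooses one expansion of every [x] in [E]; outside [E] it takes the empty one as a dummy. *)
have /choice[sc scP] (x : V) : exists p : seq V * (V -> K), E x ->
    [/\ uniq p.1, forall v, v \in p.1 -> B v & x = \sum_(v <- p.1) p.2 v *: v].
  have [Ex|nEx] := pselect (E x); last by exists ([::], fun=> 0).
  by have [s [c H]] := spanB x Ex; exists (s, c).
pose J := {v : V | B v}.
pose a0 (a : J -> K) v := if pselect (B v) is left h then a (exist _ v h) else 0.
have a0E a j : a0 a (sval j) = a j.
  case: j => v Bv; rewrite /a0 /=; case: pselect => // Bv'.
  by rewrite (Prop_irrelevance Bv' Bv).
exists J, sval, (fun a x => \sum_(v <- (sc x).1) (sc x).2 v * a0 a v); split.
- by move=> [v Bv]; exact: BE.
- move=> a j; rewrite -[RHS](a0E a).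
  have Bj : B (sval j) by case: j.
  have [us sB jE] := scP _ (BE _ Bj).
  have jB v : v \in [:: sval j] -> B v by rewrite inE => /eqP ->.
  have nB v : v \in [::] -> B v by [].
  (* The expansion chosen for a basis vector need not be the one-term one, so the two are
     compared. *)
  have := free_set_functional (a0 a) (k := 1) (s := [:: sval j])
    (t := [::]) (c := fun=> 1) (d := fun=> 0)
    (h := (sc (sval j)).2) freeB isT isT us jB nB sB.
  rewrite !big_nil !big_seq1 !addr0 !mul1r !scale1r; apply.
  by rewrite -jE.
- move=> a k x y Ex Ey Exy.
  have [us sB xE] := scP x Ex; have [ut tB yE] := scP y Ey.
  have [ur rB xyE] := scP _ Exy.
  by apply: (free_set_functional _ freeB) => //; rewrite -xE -yE -xyE.
- move=> x Ex; have [us sB ->] := scP x Ex.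
  have {us Ex} : exists s : seq J, (sc x).1 = [seq sval j | j <- s].
    elim: (sc x).1 sB => [|v s IHs] sB; first by exists [::].
    have [|s' ->] := IHs; first by move=> w ws; apply: sB; rewrite inE ws orbT.
    by exists (exist _ v (sB v (mem_head _ _)) :: s').
  move=> [s ->]; exists s, (fun j => (sc x).2 (sval j)).
  by rewrite big_map.
Qed.

End HamelBasis.

(** * Linear forms *)

Section ScalarForms.
Variables (K : numFieldType) (V : lmodType K) (L : V -> K).
Hypothesis Lscalar : scalar L.

Lemma scalar_form0 : L 0 = 0.
Proof.
have := Lscalar 1 0 0; rewrite scale1r addr0 mul1r.
by rewrite -{1}[L 0]addr0 => /addrI.
Qed.

Lemma scalar_formZ k x : L (k *: x) = k * L x.
Proof. by have := Lscalar k x 0; rewrite !addr0 scalar_form0 addr0. Qed.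

Lemma scalar_formD x y : L (x + y) = L x + L y.
Proof. by have := Lscalar 1 x y; rewrite scale1r mul1r. Qed.

Lemma scalar_formB x y : L (x - y) = L x - L y.
Proof. by rewrite scalar_formD -scaleN1r scalar_formZ mulN1r. Qed.

Lemma scalar_form_sum (I : Type) (r : seq I) (c : I -> K) (f : I -> V) :
  L (\sum_(i <- r) c i *: f i) = \sum_(i <- r) c i * L (f i).
Proof.
elim: r => [|i r IHr]; first by rewrite !big_nil scalar_form0.
by rewrite !big_cons Lscalar IHr.
Qed.

End ScalarForms.

(** * Continuous linear and bilinear forms in coordinates *)

Section Chart.
Variables (K : numFieldType) (A : topologicalLmodType K) (J : Type).
Variables (phi : A -> {ptws J -> K^o}) (psi : {ptws J -> K^o} -> A).
Hypothesis phi_scalar : forall j, scalar (fun a => phi a j : K).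
Hypotheses (phiK : cancel phi psi) (psiK : cancel psi phi).
Hypothesis psi_continuous : continuous psi.

Lemma chart0 : psi (fun=> 0) = 0.
Proof.
rewrite -[RHS]phiK; congr psi; apply/funext => j.
by rewrite (scalar_form0 (@phi_scalar j)).
Qed.

(* The sets on which finitely many coordinates vanish form a filter that
   converges to [0], although they need not be neighbourhoods of [0]. *)
Lemma nbhs0_coords (N : set A) : nbhs 0 N -> exists s : seq {classic J},
  forall a, (forall j, j \in s -> phi a j = 0) -> N a.
Proof.
pose vanish (s : seq {classic J}) : set {ptws J -> K^o} :=
  [set x | forall j, j \in s -> x j = 0].
pose F : set_system {ptws J -> K^o} := [set S | exists s, vanish s `<=` S].
have FF : Filter F.
  split; first by exists [::].
    move=> P Q [s sP] [t tQ]; exists (s ++ t) => x xst; split.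
      by apply: sP => j js; apply: xst; rewrite mem_cat js.
    by apply: tQ => j jt; apply: xst; rewrite mem_cat jt orbT.
  by move=> P Q PQ [s sP]; exists s; apply: subset_trans PQ.
have Fcvg : F --> ((fun=> 0) : {ptws J -> K^o}).
  apply: ptws_cvg => j W /nbhs_singleton W0; exists [:: j : {classic J}] => x xj.
  by rewrite /= (xj j) ?inE.
rewrite -chart0 => /psi_continuous/Fcvg[s sN]; exists s => a as0.
by have := sN (phi a) as0; rewrite /= phiK.
Qed.

Definition chart_unit (j : {classic J}) : A :=
  psi (fun i => ((i : {classic J}) == j)%:R).

Definition chart_tail (s : seq {classic J}) (a : A) :=
  a - \sum_(j <- s) phi a j *: chart_unit j.

Lemma chart_tailE s a :
  a = chart_tail s a + \sum_(j <- s) phi a j *: chart_unit j.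
Proof. by rewrite /chart_tail subrK. Qed.

Lemma chart_tail_coord s a : uniq s ->
  forall j, j \in s -> phi (chart_tail s a) j = 0.
Proof.
move=> us j js; rewrite (scalar_formB (@phi_scalar j)).
rewrite (scalar_form_sum (@phi_scalar j)) (bigD1_seq j) //= psiK eqxx mulr1.
rewrite big1 ?addr0 ?subrr // => i /negPf ij.
by rewrite psiK eq_sym ij mulr0.
Qed.

(** Near [0] the form is smaller than 1. Vectors whose coordinates in [s] vanish form a subspace
    inside that neighbourhood, and a form bounded on a subspace is zero there, by rescaling. *)
Lemma continuous_form_coords (L : A -> K^o) : scalar L -> continuous L ->
  exists s : seq {classic J},
    forall a, L a = \sum_(j <- s) L (chart_unit j) * phi a j.
Proof.
move=> Ls Lc.
have /nbhs0_coords[s sN] : nbhs 0 [set a | `|L a| < 1].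
  have := Lc 0; rewrite /continuous_at (scalar_form0 Ls) => /cvgr0_norm_lt; exact.
have tail0 a : (forall j, j \in s -> phi a j = 0) -> L a = 0.
  move=> as0; apply/eqP/negP => /negP La.
  have : `|L ((L a)^-1 *: a)| < 1.
    apply: (sN) => j js.
    by rewrite (scalar_formZ (@phi_scalar j)) as0 // mulr0.
  by rewrite (scalar_formZ Ls) mulVf // normr1 ltxx.
(* A repeated index would be subtracted twice in [chart_tail]. *)
exists (undup s) => a.
rewrite {1}(chart_tailE (undup s) a) (scalar_formD Ls) (scalar_form_sum Ls).
rewrite tail0 ?add0r; first by apply: eq_bigr => j _; rewrite mulrC.
by move=> j js; apply: chart_tail_coord; rewrite ?undup_uniq ?mem_undup.
Qed.

(** The same rescaling shows that [beta] vanishes on pairs of tails. Splitting first [a], then [b],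
    into tail and finite part leaves two finite sums, indexed by the two summands of the sum
    type. *)
Lemma continuous_bilinear_finite_rank (beta : A -> A -> K^o) :
  (forall a, scalar (beta a)) -> (forall b, scalar (beta^~ b)) ->
  continuous (fun p : A * A => beta p.1 p.2) ->
  exists (I : Type) (r : seq I) (P Q : A -> I -> K),
    forall a b, beta a b = \sum_(i <- r) P a i * Q b i.
Proof.
move=> bl br bc.
have /= [[N1 N2] [N1n N2n] N12] :
    nbhs ((0, 0) : A * A) [set p | `|beta p.1 p.2| < 1].
  have := bc (0, 0).
  rewrite /continuous_at /= (scalar_form0 (bl 0)) => /cvgr0_norm_lt; exact.
have /nbhs0_coords[s0 sN] : nbhs 0 (N1 `&` N2) by exact: filterI.
pose s := undup s0.
have tail0 a b : (forall j, j \in s -> phi a j = 0) ->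
    (forall j, j \in s -> phi b j = 0) -> beta a b = 0.
  move=> as0 bs0; apply/eqP/negP => /negP ab.
  have : `|beta ((beta a b)^-1 *: a) b| < 1.
    apply: (N12 (_, _)); split => /=.
      apply: (sN _ _).1 => j js.
      by rewrite (scalar_formZ (@phi_scalar j)) as0 ?mulr0 ?mem_undup.
    by apply: (sN _ _).2 => j js; rewrite bs0 ?mem_undup.
  by rewrite (scalar_formZ (br b)) mulVf // normr1 ltxx.
exists ({classic J} + {classic J})%type, (map inl s ++ map inr s).
exists (fun a i => match i with
                   | inl j => phi a j
                   | inr j => beta (chart_tail s a) (chart_unit j) end).
exists (fun b i => match i with
                   | inl j => beta (chart_unit j) b
                   | inr j => phi b j end).
move=> a b; rewrite big_cat !big_map /=.
rewrite {1}(chart_tailE s a) (scalar_formD (br b)) (scalar_form_sum (br b)).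
rewrite addrC; congr (_ + _).
rewrite {1}(chart_tailE s b) (scalar_formD (bl _)) (scalar_form_sum (bl _)).
rewrite tail0 ?add0r; first by apply: eq_bigr => j _; rewrite mulrC.
- by move=> j; apply: chart_tail_coord; rewrite undup_uniq.
- by move=> j; apply: chart_tail_coord; rewrite undup_uniq.
Qed.

End Chart.

(** * Finite-rank forms and Gram matrices *)

Section HankelFactorization.
Variables (F : fieldType) (X Y : Type) (beta : X -> Y -> F).

Definition gram n (x : 'I_n -> X) (y : 'I_n -> Y) :=
  \matrix_(i, j) beta (x i) (y j).

(** The Gram matrix factors through a space of dimension [size r], which bounds its rank. *)
Lemma gram_size (I : Type) (r : seq I) (P : X -> I -> F) (Q : Y -> I -> F) n
    (x : 'I_n -> X) (y : 'I_n -> Y) :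
  (forall a b, beta a b = \sum_(i <- r) P a i * Q b i) ->
  gram x y \in unitmx -> (n <= size r)%N.
Proof.
move=> PQ; rewrite -row_free_unit => /eqP <-.
pose p := \matrix_(i < n, k < size r) P (x i) (tnth (in_tuple r) k).
pose q := \matrix_(k < size r, j < n) Q (y j) (tnth (in_tuple r) k).
suff -> : gram x y = p *m q.
  exact: leq_trans (mxrankM_maxl _ _) (rank_leq_col _).
apply/matrixP => i j; rewrite !mxE PQ big_tnth.
by apply: eq_bigr => k _; rewrite !mxE.
Qed.

(** Multiplying by the unitriangular [T] clears the block [u], so the determinant is the Schur
    complement times [\det M]. *)
Lemma schur_unitmx n (c : 'M[F]_1) (u : 'rV[F]_n)
    (v : 'cV[F]_n) (M : 'M[F]_n) :
  M \in unitmx ->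
  (block_mx c u v M \in unitmx) = (c - u *m invmx M *m v != 0).
Proof.
move=> uM; pose T := block_mx 1%:M (- (u *m invmx M)) 0 1%:M.
have detT : \det T = 1 by rewrite det_ublock !det1 mulr1.
have TE : T *m block_mx c u v M = block_mx (c - u *m invmx M *m v) 0 v M.
  rewrite mulmx_block !mul1mx !mul0mx !add0r !mulNmx mulmxKV //.
  by rewrite subrr.
rewrite unitmxE -[\det _]mul1r -detT -det_mulmx TE det_lblock unitrM.
have -> : \det M \is a GRing.unit by rewrite -unitmxE.
rewrite andbT det_mx11 unitfE; congr negb; apply/eqP/eqP => [c0|->].
  by apply/matrixP => i j; rewrite !ord1 c0 mxE.
by rewrite mxE.
Qed.

(* A largest invertible Gram matrix determines the form: adding one row and
   one column gives a singular matrix, so its Schur complement vanishes. *)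
Lemma gram_factorization (I : Type) (r : seq I) (P : X -> I -> F)
    (Q : Y -> I -> F) :
  (forall a b, beta a b = \sum_(i <- r) P a i * Q b i) ->
  exists n (x : 'I_n -> X) (y : 'I_n -> Y), gram x y \in unitmx /\
    forall a b, beta a b = ((\row_j beta a (y j)) *m invmx (gram x y)
                             *m (\col_i beta (x i) b)) 0 0.
Proof.
move=> PQ.
pose has_gram n := `[< exists (x : 'I_n -> X) (y : 'I_n -> Y),
  gram x y \in unitmx >].
have gram0 : exists n, has_gram n.
  exists 0%N; apply/asboolP.
  have no (T : Type) : 'I_0 -> T by case.
  by exists (no X), (no Y); rewrite unitmxE det_mx00 unitr1.
have gram_le n : has_gram n -> (n <= size r)%N.
  by move=> /asboolP[x [y]]; apply: gram_size PQ.
case: (ex_maxnP gram0 gram_le) => n /asboolP[x [y uM]] maxn.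
exists n, x, y; split=> // a b.
(* The new points [a] and [b] take index 0, so the bordered Gram matrix has corner [beta a b]. *)
pose x' (i : 'I_(1 + n)) := if fintype.split i is inr k then x k else a.
pose y' (i : 'I_(1 + n)) := if fintype.split i is inr k then y k else b.
have : gram x' y' \notin unitmx.
  apply/negP => u'; have /maxn : has_gram (1 + n)%N by apply/asboolP; exists x', y'.
  by rewrite add1n ltnn.
have -> : gram x' y' = block_mx (\matrix_(_ < 1, _ < 1) beta a b)
    (\row_j beta a (y j)) (\col_i beta (x i) b) (gram x y).
  apply/matrixP => i j; rewrite !mxE /x' /y'.
  by case: (fintype.split i) => i'; rewrite !mxE; case: (fintype.split j) => j'; rewrite !mxE.
rewrite schur_unitmx // negbK subr_eq0 => /eqP/matrixP/(_ 0 0).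
by rewrite mxE.
Qed.

End HankelFactorization.

(** * Matrix coefficients of continuous finite-dimensional representations *)

Section Representative.
Variables (K : numFieldType) (g : topologicalLmodType K) (br : g -> g -> g).

Definition word_mx n (rho : g -> 'M[K]_n) (w : seq g) : 'M[K]_n :=
  foldr (fun x M => rho x *m M) 1%:M w.

Definition continuous_rep n (rho : g -> 'M[K]_n) :=
  [/\ forall (k : K) x y, rho (k *: x + y) = k *: rho x + rho y,
      forall x y, rho (br x y) = rho x *m rho y - rho y *m rho x &
      forall i j, continuous (fun x => rho x i j : K^o)].

(* Matrix coefficients, on words in [g], of the continuous
   finite-dimensional representations. *)
Definition representative : set (seq g -> K^o) := [set f |
  exists n (rho : g -> 'M[K]_n) (u : 'rV[K]_n) (v : 'cV[K]_n),
    continuous_rep rho /\ forall w, f w = (u *m word_mx rho w *m v) 0 0].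

Lemma word_mx_cat n (rho : g -> 'M[K]_n) w1 w2 :
  word_mx rho (w1 ++ w2) = word_mx rho w1 *m word_mx rho w2.
Proof. by elim: w1 => [|x w IHw] /=; rewrite ?mul1mx // IHw mulmxA. Qed.

Lemma word_mx1 n (rho : g -> 'M[K]_n) x : word_mx rho [:: x] = rho x.
Proof. by rewrite /= mulmx1. Qed.

Lemma representative0 : representative 0.
Proof.
exists 0%N, (fun=> 0), 0, 0; split=> [|w]; last by rewrite !mul0mx mxE.
by split=> [k x y|x y|[]//]; apply/matrixP => [[]].
Qed.

(** The sum is a coefficient of the direct sum of the two representations, with [k] absorbed into
    the row vector. *)
Lemma representative_lin (k : K) f h :
  representative f -> representative h -> representative (k *: f + h).
Proof.
move=> [n1 [r1 [u1 [v1 [[l1 b1 c1] f1]]]]] [n2 [r2 [u2 [v2 [[l2 b2 c2] f2]]]]].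
pose rho x := block_mx (r1 x) 0 0 (r2 x).
have word_rho w : word_mx rho w = block_mx (word_mx r1 w) 0 0 (word_mx r2 w).
  elim: w => [|x w /= ->]; first by rewrite /= -scalar_mx_block.
  by rewrite /rho mulmx_block !mul0mx !mulmx0 !addr0 !add0r.
exists (n1 + n2)%N, rho, (row_mx (k *: u1) u2), (col_mx v1 v2).
split; first split.
- by move=> c x y; rewrite /rho l1 l2 scale_block_mx add_block_mx !scaler0 !addr0.
- move=> x y; rewrite /rho b1 b2 !mulmx_block !mul0mx !mulmx0 !addr0 !add0r.
  by rewrite opp_block_mx add_block_mx !oppr0 !addr0.
- move=> i j; rewrite /rho -(splitK i) -(splitK j).
  case: (fintype.split i) => i'; case: (fintype.split j) => j' /=.
  + by under eq_fun do rewrite block_mxEul; exact: c1.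
  + under eq_fun do rewrite block_mxEur mxE; exact: continuous_constf.
  + under eq_fun do rewrite block_mxEdl mxE; exact: continuous_constf.
  + by under eq_fun do rewrite block_mxEdr; exact: c2.
- move=> w; rewrite word_rho mul_row_block !mulmx0 addr0 add0r mul_row_col.
  rewrite mxE -!scalemxAl mxE -f1 -f2 //.
Qed.

Lemma representative_sum (I : Type) (r : seq I) (c : I -> K)
    (f : I -> seq g -> K^o) :
  (forall i, representative (f i)) ->
  representative (\sum_(i <- r) c i *: f i).
Proof.
move=> rf; elim: r => [|i r IHr]; first by rewrite big_nil; exact: representative0.
by rewrite big_cons; exact: representative_lin.
Qed.

(* The comultiplication dual to concatenation. *)
Lemma representative_cat f : representative f ->
  exists n (L R : 'I_n -> seq g -> K^o),
  [/\ forall i, representative (L i), forall i, representative (R i) &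
      forall w1 w2, f (w1 ++ w2) = \sum_i L i w1 * R i w2].
Proof.
move=> [n [rho [u [v [rep fE]]]]].
(* The product of the matrices of [w1] and [w2] is expanded along the middle index; each factor is a
   coefficient against a standard basis vector. *)
exists n, (fun i w => (u *m word_mx rho w) 0 i).
exists (fun i w => (word_mx rho w *m v) i 0); split=> [i|i|w1 w2].
- exists n, rho, u, (delta_mx i 0); split=> // w.
  by rewrite -colE [RHS]mxE.
- exists n, rho, (delta_mx 0 i), v; split=> // w.
  by rewrite -mulmxA -rowE [RHS]mxE.
- by rewrite fE word_mx_cat mulmxA -mulmxA mxE.
Qed.

(** This and the next two lemmas become linearity, bracket compatibility and continuity of
    [env_map], coordinate by coordinate. *)
Lemma representative_letter_lin f k x y : representative f ->
  f [:: k *: x + y] = k * f [:: x] + f [:: y].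
Proof.
move=> [n [rho [u [v [[lin _ _] fE]]]]]; rewrite !fE !word_mx1 lin.
by rewrite mulmxDr mulmxDl -scalemxAr -scalemxAl !mxE.
Qed.

Lemma representative_letter_br f x y : representative f ->
  f [:: br x y] = f [:: x; y] - f [:: y; x].
Proof.
move=> [n [rho [u [v [[_ brE _] fE]]]]]; rewrite !fE word_mx1 brE.
by rewrite /= !mulmx1 mulmxBr mulmxBl !mxE.
Qed.

Lemma representative_letter_continuous f : representative f ->
  continuous (fun x => f [:: x]).
Proof.
move=> [n [rho [u [v [[_ _ cont] fE]]]]].
under eq_fun do rewrite fE word_mx1 mxE.
apply: continuous_sumf => i.
under eq_fun do rewrite mxE.
apply: continuous_mulf; last exact: continuous_constf.
apply: continuous_sumf => j; apply: continuous_mulf; last exact: cont.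
exact: continuous_constf.
Qed.

End Representative.

(** * The enveloping algebra as the dual of the space of matrix coefficients *)

Section Envelope.
Variables (K : numFieldType) (g : topologicalLmodType K) (br : g -> g -> g).
Local Notation E := (representative br).

Variables (J : Type) (e : J -> seq g -> K^o).
Variable ext : (J -> K) -> (seq g -> K^o) -> K.
Hypothesis e_repr : forall j, E (e j).
Hypothesis ext_e : forall a j, ext a (e j) = a j.
Hypothesis ext_lin : forall a k f h, E f -> E h -> E (k *: f + h) ->
  ext a (k *: f + h) = k * ext a f + ext a h.
Hypothesis e_span : forall f, E f -> exists (s : seq J) (c : J -> K),
  f = \sum_(j <- s) c j *: e j.

Local Notation U := (power K J).

Lemma functional_sum (L : (seq g -> K^o) -> K) (I : Type) (r : seq I)
    (c : I -> K) (f : I -> seq g -> K^o) :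
  (forall k h1 h2, E h1 -> E h2 -> L (k *: h1 + h2) = k * L h1 + L h2) ->
  (forall i, E (f i)) ->
  L (\sum_(i <- r) c i *: f i) = \sum_(i <- r) c i * L (f i).
Proof.
move=> Llin Ef; have L0 : L 0 = 0.
  have := Llin 1 0 0 (representative0 br) (representative0 br).
  by rewrite scale1r addr0 mul1r -{1}[L 0]addr0 => /addrI.
elim: r => [|i r IHr]; first by rewrite !big_nil.
by rewrite !big_cons Llin ?IHr //; exact: representative_sum.
Qed.

Lemma ext_linear a k f h : E f -> E h ->
  ext a (k *: f + h) = k * ext a f + ext a h.
Proof. by move=> Ef Eh; apply: ext_lin => //; exact: representative_lin. Qed.

Lemma ext_sum a (I : Type) (r : seq I) (c : I -> K) (f : I -> seq g -> K^o) :
  (forall i, E (f i)) ->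
  ext a (\sum_(i <- r) c i *: f i) = \sum_(i <- r) c i * ext a (f i).
Proof. by move=> Ef; apply: functional_sum => // k h1 h2; exact: ext_linear. Qed.

(** Both sides are linear on [E] and agree on the spanning family [e]. This evaluates products and
    words at every element of [E], although they are defined only by their values on the basis. *)
Lemma ext_functional (L : (seq g -> K^o) -> K) f :
  (forall k h1 h2, E h1 -> E h2 -> L (k *: h1 + h2) = k * L h1 + L h2) ->
  E f -> ext (fun j => L (e j)) f = L f.
Proof.
move=> Llin Ef; have [s [c ->]] := e_span Ef.
rewrite ext_sum // functional_sum //.
by apply: eq_bigr => j _; rewrite ext_e.
Qed.

(** The coefficients are independent of [a], whence linearity and continuity in [a]. *)
Lemma ext_coords f : E f -> exists (s : seq J) (c : J -> K),
  forall a, ext a f = \sum_(j <- s) c j * a j.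
Proof.
move=> Ef; have [s [c ->]] := e_span Ef; exists s, c => a.
by rewrite ext_sum //; apply: eq_bigr => j _; rewrite ext_e.
Qed.

Lemma ext_scalar f : E f -> scalar (fun a : U => ext a f).
Proof.
move=> /ext_coords[s [c fE]] k a b; rewrite !fE mulr_sumr -big_split /=.
by apply: eq_bigr => j _; rewrite mulrDr mulrCA.
Qed.

Lemma ext_continuous f : E f -> continuous (fun a : U => ext a f : K^o).
Proof.
move=> /ext_coords[s [c fE]]; under eq_fun do rewrite fE.
apply: continuous_sumf => j; apply: continuous_mulf.
  exact: continuous_constf.
exact: ptws_coord_continuous.
Qed.

Definition conv (a b : U) (f : seq g -> K^o) : K :=
  ext a (fun w1 => ext b (fun w2 => f (w1 ++ w2))).

Lemma cat_sum f n (L R : 'I_n -> seq g -> K^o) w :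
  (forall w1 w2, f (w1 ++ w2) = \sum_i L i w1 * R i w2) ->
  (fun w' => f (w ++ w')) = \sum_i L i w *: R i.
Proof.
by move=> fE; apply/funext => w'; rewrite fE fct_sumE; apply: eq_bigr.
Qed.

Lemma representative_shift f w : E f -> E (fun w' => f (w ++ w')).
Proof.
move=> /representative_cat[n [L [R [_ ER fE]]]].
by rewrite (cat_sum w fE); exact: representative_sum.
Qed.

Lemma ext_shift (b : U) f n (L R : 'I_n -> seq g -> K^o) :
  (forall i, E (R i)) ->
  (forall w1 w2, f (w1 ++ w2) = \sum_i L i w1 * R i w2) ->
  (fun w => ext b (fun w' => f (w ++ w'))) = \sum_i ext b (R i) *: L i.
Proof.
move=> ER fE; apply/funext => w; rewrite (cat_sum w fE) ext_sum // fct_sumE.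
by apply: eq_bigr => i _; rewrite mulrC.
Qed.

(** Since [ext a] is linear only on [E], the inner function of [conv] has to lie there; the finite
    comultiplication makes it a combination of the [L i]. *)
Lemma representative_ext (b : U) f : E f ->
  E (fun w => ext b (fun w' => f (w ++ w'))).
Proof.
move=> /representative_cat[n [L [R [EL ER fE]]]].
by rewrite (ext_shift b ER fE); exact: representative_sum.
Qed.

(** Separating [a] from [b] in a finite sum gives linearity in [b] and joint continuity of the
    product. *)
Lemma conv_sum f : E f -> exists n (L R : 'I_n -> seq g -> K^o),
  [/\ forall i, E (L i), forall i, E (R i) &
      forall a b, conv a b f = \sum_i ext a (L i) * ext b (R i)].
Proof.
move=> /representative_cat[n [L [R [EL ER fE]]]]; exists n, L, R; split=> // a b.
rewrite /conv (ext_shift b ER fE) ext_sum //.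
by apply: eq_bigr => i _; rewrite mulrC.
Qed.

Lemma conv_linear a b k f h : E f -> E h ->
  conv a b (k *: f + h) = k * conv a b f + conv a b h.
Proof.
move=> Ef Eh; rewrite /conv -ext_linear; try exact: representative_ext.
congr (ext a _); apply/funext => w.
exact: (ext_linear b k (representative_shift w Ef) (representative_shift w Eh)).
Qed.

Definition env_mul (a b : U) : U := fun j => conv a b (e j).
Definition env_word (w : seq g) : U := fun j => e j w.
Definition env_one : U := env_word [::].
Definition env_map (x : g) : U := env_word [:: x].

Lemma ext_mul a b f : E f -> ext (env_mul a b) f = conv a b f.
Proof. by apply: (@ext_functional (conv a b)) => k h1 h2; exact: conv_linear. Qed.

Lemma ext_word w f : E f -> ext (env_word w) f = f w.
Proof. by apply: (@ext_functional (fun f => f w)). Qed.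

Lemma env_mul_word w1 w2 :
  env_mul (env_word w1) (env_word w2) = env_word (w1 ++ w2).
Proof.
apply/funext => j; rewrite /env_mul /conv ext_word; last exact: representative_ext.
by rewrite ext_word //; exact: representative_shift.
Qed.

(** Both sides unfold to [a], [b], [c] applied in turn to a function of [w1 w2 w3], so associativity
    of concatenation suffices. *)
Lemma env_mulA : associative env_mul.
Proof.
move=> a b c; apply/funext => j.
rewrite -[LHS]/(conv a (env_mul b c) (e j)) -[RHS]/(conv (env_mul a b) c (e j)).
rewrite {2}/conv (ext_mul _ _ (representative_ext _ (e_repr j))).
congr (ext a _); apply/funext => w1.
rewrite (ext_mul _ _ (representative_shift w1 (e_repr j))).
congr (ext b _); apply/funext => w2; congr (ext c _); apply/funext => w3.
by rewrite catA.
Qed.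

Lemma env_mul_linearl (k : K) a b c :
  env_mul (k *: a + b) c = k *: env_mul a c + env_mul b c.
Proof.
apply/funext => j; rewrite /env_mul /conv.
exact: (ext_scalar (representative_ext _ (e_repr j))).
Qed.

Lemma env_mul_linearr (k : K) a b c :
  env_mul c (k *: a + b) = k *: env_mul c a + env_mul c b.
Proof.
apply/funext => j; have [n [L [R [EL ER cE]]]] := conv_sum (e_repr j).
rewrite /env_mul !fctE !cE [in RHS]/GRing.scale /= mulr_sumr -big_split /=.
by apply: eq_bigr => i _; rewrite (ext_scalar (ER i)) mulrDr mulrCA.
Qed.

Lemma env_1mul : left_id env_one env_mul.
Proof.
move=> a; apply/funext => j; rewrite /env_mul /conv ext_word ?ext_e //.
exact: representative_ext.
Qed.

Lemma env_mul1 : right_id env_one env_mul.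
Proof.
move=> a; apply/funext => j; rewrite /env_mul /conv -[RHS](ext_e a).
congr (ext a _); apply/funext => w; rewrite ext_word ?cats0 //.
exact: representative_shift.
Qed.

Lemma env_mul_continuous : continuous (fun p : U * U => env_mul p.1 p.2).
Proof.
apply: ptws_continuous => j; have [n [L [R [EL ER cE]]]] := conv_sum (e_repr j).
rewrite /env_mul; under eq_fun do rewrite cE.
apply: continuous_sumf => i; apply: continuous_mulf => p.
- apply: (@continuous_comp _ _ _ fst (fun a : U => ext a (L i) : K^o)).
    exact: cvg_fst.
  exact: ext_continuous.
- apply: (@continuous_comp _ _ _ snd (fun a : U => ext a (R i) : K^o)).
    exact: cvg_snd.
  exact: ext_continuous.
Qed.

Lemma env_wc_unital_algebra : wc_unital_algebra env_mul env_one.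
Proof.
split; last exact: env_mul_continuous.
  by exists J, id, id; split=> //; split=> //; split=> //; split=> x; exact: cvg_id.
have mul0 a : env_mul 0 a = 0 /\ env_mul a 0 = 0.
  (* With scalar -1 and equal arguments the right-hand sides cancel. *)
  have := env_mul_linearl (-1) 0 0 a; have := env_mul_linearr (-1) 0 0 a.
  by rewrite scaler0 addr0 !scaleN1r !addNr.
split; last by split; [exact: env_1mul|exact: env_mul1].
split; first exact: env_mulA.
- by move=> a b c; have := env_mul_linearl 1 a b c; rewrite !scale1r.
- by move=> a b c; have := env_mul_linearr 1 b c a; rewrite !scale1r.
- move=> k a b; have := env_mul_linearl k a 0 b.
  by rewrite (mul0 b).1 !addr0.
- move=> k a b; have := env_mul_linearr k b 0 a.
  by rewrite (mul0 a).2 !addr0.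
Qed.

Lemma env_map_lie : lie_morphism_to_alg br env_mul env_map.
Proof.
split.
- by move=> k x y; apply/funext => j; exact: (representative_letter_lin _ _ _ (e_repr j)).
- move=> x y; rewrite !env_mul_word; apply/funext => j.
  exact: (representative_letter_br _ _ (e_repr j)).
- apply: ptws_continuous => j.
  exact: (representative_letter_continuous (e_repr j)).
Qed.


(** * Lifting a Lie morphism to a weakly complete algebra *)

Section Target.
Variables (A : topologicalLmodType K) (mul : A -> A -> A) (one : A).
Hypothesis algA : unital_algebra mul one.
Hypothesis mul_continuous : continuous (fun p : A * A => mul p.1 p.2).
Variables (I : Type) (phi : A -> {ptws I -> K^o}) (psi : {ptws I -> K^o} -> A).
Hypothesis phi_scalar : forall i, scalar (fun a => phi a i : K).
Hypotheses (phiK : cancel phi psi) (psiK : cancel psi phi).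
Hypotheses (phi_continuous : continuous phi) (psi_continuous : continuous psi).
Variable f : g -> A.
Hypothesis f_lie : lie_morphism_to_alg br mul f.

Let mulA : associative mul. Proof. by case: algA => -[]. Qed.
Let one_mul : left_id one mul. Proof. by case: algA => _ []. Qed.
Let mul_one : right_id one mul. Proof. by case: algA => _ []. Qed.

Let mul_linl k a b c : mul (k *: a + b) c = k *: mul a c + mul b c.
Proof. by case: algA => -[_ Dl _ Zl _] _; rewrite Dl Zl. Qed.

Let mul_linr k a b c : mul c (k *: a + b) = k *: mul c a + mul c b.
Proof. by case: algA => -[_ _ Dr _ Zr] _; rewrite Dr Zr. Qed.

Let mull_continuous c : continuous (mul c).
Proof.
move=> a; apply: (@continuous_comp _ _ _ (fun b => (c, b))
  (fun p : A * A => mul p.1 p.2)); last exact: mul_continuous.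
by apply: cvg_pair; [exact: cvg_cst|exact: cvg_id].
Qed.

Let mulr_continuous c : continuous (mul^~ c).
Proof.
move=> a; apply: (@continuous_comp _ _ _ (fun b => (b, c))
  (fun p : A * A => mul p.1 p.2)); last exact: mul_continuous.
by apply: cvg_pair; [exact: cvg_id|exact: cvg_cst].
Qed.

Definition word_mul (w : seq g) : A := foldr (fun x => mul (f x)) one w.

Lemma word_mul_cat w1 w2 : word_mul (w1 ++ w2) = mul (word_mul w1) (word_mul w2).
Proof. by elim: w1 => [|x w IHw] /=; rewrite ?one_mul // IHw mulA. Qed.

(* The Gram matrix [M] of [xi (a b)] on suitable [x_i], [y_j] yields the
   representation [b |-> (xi (x_i b y_j)) M^-1], of which [xi] is a
   coefficient. *)
Lemma functional_representative (xi : A -> K^o) :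
  scalar xi -> continuous xi -> E (fun w => xi (word_mul w)).
Proof.
move=> xis xic; pose beta a b : K^o := xi (mul a b).
have betal a : scalar (beta a) by move=> k b c; rewrite /beta mul_linr xis.
have betar b : scalar (beta^~ b) by move=> k a c; rewrite /beta mul_linl xis.
have betac : continuous (fun p : A * A => beta p.1 p.2).
  move=> p; apply: (@continuous_comp _ _ _ (fun p : A * A => mul p.1 p.2) xi).
    exact: mul_continuous.
  exact: xic.
have [I' [r [P [Q PQ]]]] := continuous_bilinear_finite_rank phi_scalar phiK psiK
  psi_continuous betal betar betac.
have [n [x [y [uM betaE]]]] := gram_factorization PQ.
set M := gram _ _ _ in uM betaE.
pose H b : 'M[K]_n := \matrix_(i, j) xi (mul (mul (x i) b) (y j)).
have H1 : H one = M by apply/matrixP => i j; rewrite !mxE mul_one.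
(* Bracketing [x_i b c y_j] as [(x_i b)(c y_j)] and factoring [beta] through [M] makes [rho]
   multiplicative. *)
have HM b c : H (mul b c) = H b *m invmx M *m H c.
  apply/matrixP => i j; rewrite mxE mulA -mulA -[LHS]/(beta _ _) betaE.
  rewrite -[H b *m _ *m _]mulmxA [RHS]mxE -mulmxA [LHS]mxE.
  apply: eq_bigr => k _; congr (_ * _); first by rewrite !mxE.
  rewrite !mxE; apply: eq_bigr => l _; congr (_ * _).
  by rewrite !mxE /beta mulA.
pose rho b := H b *m invmx M.
have rho1 : rho one = 1%:M by rewrite /rho H1 mulmxV.
have rhoM b c : rho (mul b c) = rho b *m rho c.
  by rewrite /rho HM !mulmxA.
have rho_lin k b c : rho (k *: b + c) = k *: rho b + rho c.
  rewrite /rho scalemxAl -mulmxDl; congr (_ *m _).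
  by apply/matrixP => i j; rewrite !mxE mul_linr mul_linl xis.
have rhoB b c : rho (b - c) = rho b - rho c.
  by rewrite addrC -scaleN1r rho_lin scaleN1r addrC.
case: f_lie => f_lin f_br f_cont.
have repf : continuous_rep br (rho \o f).
  split=> [k a b|a b|i j] /=; first by rewrite f_lin rho_lin.
    by rewrite f_br rhoB !rhoM.
  under eq_fun do rewrite mxE.
  apply: continuous_sumf => l; apply: continuous_mulf.
    under eq_fun do rewrite mxE.
    move=> a; apply: (@continuous_comp _ _ _ f
      (fun b => xi (mul (mul (x i) b) (y l)))); first exact: f_cont.
    apply: (@continuous_comp _ _ _ (mul (x i)) (fun b => xi (mul b (y l)))).
      exact: mull_continuous.
    apply: (@continuous_comp _ _ _ (mul^~ (y l)) xi).
      exact: mulr_continuous.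
    exact: xic.
  exact: continuous_constf.
(* Factoring [xi(1 w)] through [M], and then each [beta (x_i w) 1] again, produces exactly these row
   and column vectors. *)
exists n, (rho \o f), ((\row_j beta one (y j)) *m invmx M).
exists (\col_i beta (x i) one); split=> // w.
have -> : word_mx (rho \o f) w = rho (word_mul w).
  by elim: w => [|a w IHw] /=; rewrite ?rho1 // IHw rhoM.
rewrite -[word_mul w in LHS]one_mul -[LHS]/(beta _ _) betaE.
rewrite -[(_ *m rho _) *m _]mulmxA; congr ((_ *m _) 0 0).
apply/matrixP => i j; rewrite ord1 [LHS]mxE.
have -> : beta (x i) (word_mul w) = beta (mul (x i) (word_mul w)) one.
  by rewrite /beta mul_one.
rewrite betaE /rho -!mulmxA [LHS]mxE [RHS]mxE.
by apply: eq_bigr => k _; congr (_ * _); rewrite !mxE.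
Qed.

Let phi_coord_continuous i : continuous (fun a => phi a i).
Proof.
move=> a; apply: (@continuous_comp _ _ _ phi (fun h : {ptws I -> K^o} => h i)).
  exact: phi_continuous.
exact: ptws_coord_continuous.
Qed.

Lemma coord_representative i : E (fun w => phi (word_mul w) i).
Proof.
exact: (functional_representative (@phi_scalar i) (@phi_coord_continuous i)).
Qed.

Definition env_lift (a : U) : A :=
  psi (fun i => ext a (fun w => phi (word_mul w) i)).

Lemma env_lift_coord a i : phi (env_lift a) i = ext a (fun w => phi (word_mul w) i).
Proof. by rewrite /env_lift psiK. Qed.

(** The definition gives this for the coordinates, and a continuous form is a finite combination of
    those. It is applied to coordinates composed with multiplications. *)
Lemma env_lift_functional (xi : A -> K^o) a : scalar xi -> continuous xi ->
  xi (env_lift a) = ext a (fun w => xi (word_mul w)).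
Proof.
move=> xis xic.
have [s xiE] := continuous_form_coords phi_scalar phiK psiK psi_continuous xis xic.
rewrite xiE (_ : (fun w => xi (word_mul w)) =
    \sum_(i <- s) xi (chart_unit psi i) *: (fun w => phi (word_mul w) i)).
  rewrite ext_sum; last by move=> i; exact: coord_representative.
  by apply: eq_bigr => i _; rewrite env_lift_coord.
by apply/funext => w; rewrite xiE fct_sumE.
Qed.

Lemma env_lift_word w : env_lift (env_word w) = word_mul w.
Proof.
rewrite -[RHS]phiK; congr psi; apply/funext => i.
by rewrite ext_word //; exact: coord_representative.
Qed.

(** In each coordinate, [env_lift_functional] is used for right multiplication by [env_lift b], then
    for left multiplication by the image of a word; the nested evaluations form [conv a b]. *)
Lemma env_lift_mul a b : env_lift (env_mul a b) = mul (env_lift a) (env_lift b).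
Proof.
apply: (can_inj phiK); apply/funext => i.
rewrite env_lift_coord ext_mul; last exact: coord_representative.
rewrite (env_lift_functional (xi := fun c => phi (mul c (env_lift b)) i)).
- rewrite /conv; congr (ext a _); apply/funext => w1.
  rewrite (env_lift_functional (xi := fun c => phi (mul (word_mul w1) c) i)).
  + by congr (ext b _); apply/funext => w2; rewrite word_mul_cat.
  + by move=> k c d; rewrite mul_linr phi_scalar.
  + move=> c; apply: (@continuous_comp _ _ _ (mul (word_mul w1))
      (fun d => phi d i)); first exact: mull_continuous.
    exact: phi_coord_continuous.
- by move=> k c d; rewrite mul_linl phi_scalar.
- move=> c; apply: (@continuous_comp _ _ _ (mul^~ (env_lift b))
    (fun d => phi d i)); first exact: mulr_continuous.
  exact: phi_coord_continuous.
Qed.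

Lemma env_lift_morphism : wc_alg_morphism env_mul env_one mul one env_lift.
Proof.
split; [|exact: env_lift_mul|exact: env_lift_word|].
- move=> k a b; apply: (can_inj phiK); apply/funext => i.
  by rewrite phi_scalar !env_lift_coord (ext_scalar (coord_representative i)).
- move=> a; apply: (@continuous_comp _ _ _
    (fun a : U => (fun i => ext a (fun w => phi (word_mul w) i)) :
      {ptws I -> K^o}) psi); last exact: psi_continuous.
  by apply: ptws_continuous => i; exact: (ext_continuous (coord_representative i)).
Qed.

Lemma env_lift_map x : env_lift (env_map x) = f x.
Proof. by rewrite env_lift_word /= mul_one. Qed.

(** On words [h] is forced. Each coordinate of [h] is a continuous form on [U], hence evaluation at
    some element of [E], and the values of that function are read off on words. *)
Lemma env_lift_unique (h : U -> A) :
  wc_alg_morphism env_mul env_one mul one h ->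
  (forall x, h (env_map x) = f x) -> h = env_lift.
Proof.
move=> [h_lin h_mul h_one h_cont] hf.
have h_word w : h (env_word w) = word_mul w.
  elim: w => [|x w IHw] //=.
  by rewrite -cat1s -env_mul_word h_mul IHw -hf.
apply/funext => a; apply: (can_inj phiK); apply/funext => i.
have his : scalar (fun b : U => phi (h b) i : K).
  by move=> k b c; rewrite h_lin phi_scalar.
have hic : continuous (fun b : U => phi (h b) i).
  move=> b; apply: (@continuous_comp _ _ _ h (fun c => phi c i)).
    exact: h_cont.
  exact: phi_coord_continuous.
have [s hE] := @continuous_form_coords K U J id id (fun _ _ _ _ => erefl)
  (fun _ => erefl) (fun _ => erefl) (fun _ => cvg_id) _ his hic.
pose c j := phi (h (chart_unit (id : _ -> U) j)) i.
have hext b : phi (h b) i = ext b (\sum_(j <- s) c j *: e j).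
  by rewrite hE ext_sum //; apply: eq_bigr => j _; rewrite ext_e.
rewrite env_lift_coord hext; congr (ext a _); apply/funext => w.
by rewrite -h_word hext ext_word //; exact: representative_sum.
Qed.

End Target.

End Envelope.

(** * The universal property *)

Lemma enveloping_algebra (K : numFieldType) (g : topologicalLmodType K)
    (br : g -> g -> g) :
  exists (U : topologicalLmodType K) (mulU : U -> U -> U) (oneU : U)
         (lambda : g -> U),
    [/\ wc_unital_algebra mulU oneU,
        lie_morphism_to_alg br mulU lambda &
        forall (A : topologicalLmodType K) (mulA : A -> A -> A) (oneA : A),
          wc_unital_algebra mulA oneA ->
          forall f : g -> A, lie_morphism_to_alg br mulA f ->
          exists! f' : U -> A,
            wc_alg_morphism mulU oneU mulA oneA f' /\ f = f' \o lambda].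
Proof.
have [J [e [ext [e_repr ext_e ext_lin e_span]]]] := basis_dual (representative br).
exists (power K J), (env_mul e ext), (env_one e), (env_map e); split.
- exact: env_wc_unital_algebra e_repr ext_e ext_lin e_span.
- exact: env_map_lie e_repr ext_e ext_lin e_span.
- move=> A mul one [[I [phi [psi [phi_lin [phiK [psiK [phic psic]]]]]]] algA mulc].
  move=> f f_lie.
  have phis i : scalar (fun a => phi a i : K) by move=> k a b; exact: phi_lin.
  exists (env_lift ext mul one phi psi f); split.
    split; first exact: (env_lift_morphism e_repr ext_e ext_lin e_span algA mulc
      phis phiK psiK phic psic f_lie).
    apply/funext => x; symmetry.
    exact: (env_lift_map e_repr ext_e ext_lin e_span algA mulc
      phis phiK psiK phic psic f_lie).
  move=> h [h_morph hf]; symmetry.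
  apply: (env_lift_unique e_repr ext_e ext_lin e_span phis phiK psiK phic
    h_morph) => x.
  by rewrite hf.
Qed.

Theorem theorem1p3 (R : realType) (b : bool) :
  let K := ground_field R b in
  forall (g : topologicalLmodType K) (br : g -> g -> g),
    topological_lie_algebra br -> profinite_dimensional br ->
  exists (U : topologicalLmodType K) (mulU : U -> U -> U) (oneU : U)
         (lambda : g -> U),
    [/\ wc_unital_algebra mulU oneU,
        lie_morphism_to_alg br mulU lambda &
        forall (A : topologicalLmodType K) (mulA : A -> A -> A) (oneA : A),
          wc_unital_algebra mulA oneA ->
          forall f : g -> A, lie_morphism_to_alg br mulA f ->
          exists! f' : U -> A,
            wc_alg_morphism mulU oneU mulA oneA f' /\ f = f' \o lambda].
Proof. by move=> K g br _ _; exact: enveloping_algebra. Qed.
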